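(* Let $(E,\mathcal{T})$ be a real $L^0$-pre-barreled module such that $E$ has the countable concatenation property. Then, for every proper lower semicontinuous $L^0$-convex function $f:E\to\bar L^0(\mathcal{F})$, $\partial f(x)\neq\emptyset$ for all $x\in\mathrm{Int}(\mathrm{dom}(f))$ (the interior of $\mathrm{dom}(f)$).
   Context: Notation. $(\Omega,\mathcal{F},P)$ is a probability space; $L^0(\mathcal{F})$ is the algebra of a.s.-equivalence classes of real-valued $\mathcal{F}$-measurable random variables; $\bar L^0(\mathcal{F})$ the set of classes of extended real-valued ones, ordered a.s.; $L^0_+(\mathcal{F})=\{\xi\in L^0(\mathcal{F}):\xi\ge0\}$, $L^0_{++}(\mathcal{F})=\{\xi\in L^0(\mathcal{F}):\xi>0\text{ a.s.}\}$; $\tilde I_A$ is the class of the indicator of $A\in\mathcal{F}$. ''On $\Omega$'' means a.s. $\mathcal{T}_c$ on $L^0(\mathcal{F})$ is the topology with neighborhood base at $\xi$ given by $\{\eta:|\eta-\xi|\le\varepsilon\}$, $\varepsilon\in L^0_{++}(\mathcal{F})$; $(L^0(\mathcal{F}),\mathcal{T}_c)$ is a topological ring. Modules. Every $L^0(\mathcal{F})$-module $E$ considered is assumed to satisfy: if $x,y\in E$ and $\tilde I_{A_n}x=\tilde I_{A_n}y$ for all $n$ for some countable partition $\{A_n\}$ of $\Omega$ into members of $\mathcal{F}$, then $x=y$. A subset $G\subset E$ (possibly $G=E$) has the countable concatenation property if for every sequence $\{x_n\}$ in $G$ and every countable partition $\{A_n\}$ of $\Omega$ into members of $\mathcal{F}$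 there is $x\in G$ with $\tilde I_{A_n}x=\tilde I_{A_n}x_n$ for all $n$. $B\subset E$ is $L^0$-balanced if $\eta B\subset B$ whenever $\eta\in L^0(\mathcal{F})$, $|\eta|\le1$; $L^0$-convex if $\xi x+(1-\xi)y\in B$ for $x,y\in B$, $\xi\in L^0_+(\mathcal{F})$, $0\le\xi\le1$; $L^0$-absorbent if for each $x\in E$ there is $\xi\in L^0_{++}(\mathcal{F})$ with $\eta x\in B$ for all $\eta\in L^0(\mathcal{F})$, $|\eta|\le\xi$. A (real) locally $L^0$-convex module $(E,\mathcal{T})$ is an $L^0(\mathcal{F})$-module with a topology making it a topological module over $(L^0(\mathcal{F}),\mathcal{T}_c)$ (addition and module multiplication jointly continuous) and having a local base at $\theta$ (the null element) of $L^0$-balanced, $L^0$-absorbent, $L^0$-convex sets. An $L^0$-barrel is an $L^0$-balanced, $L^0$-absorbent, $L^0$-convex, closed set. A real $L^0$-pre-barreled module is a real locally $L^0$-convex module in which every $L^0$-barrel with the countable concatenation property is a neighborhood of $\theta$. $(E,\mathcal{T})^\ast$ is the set of continuous module homomorphisms from $(E,\mathcal{T})$ to $(L^0(\mathcal{F}),\mathcal{T}_c)$. Functions. For $f:E\to\bar L^0(\mathcal{F})$, $\mathrm{dom}(f)=\{x\in E:f(x)<+\infty\text{ on }\Omega\}$. $f$ is proper if $\mathrm{dom}(f)\ne\emptyset$ and $f(x)>-\infty$ on $\Omega$ for all $x\in E$. $f$ is $L^0$-convex if $f(\xi x+(1-\xi)y)\le\xi f(x)+(1-\xi)f(y)$ for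 all $x,y\in E$ and $\xi\in L^0_+(\mathcal{F})$, $0\le\xi\le1$, with $0\cdot(\pm\infty)=0$ and $+\infty\pm(\pm\infty)=+\infty$. $f$ is lower semicontinuous if $\{x\in E:f(x)\le r\}$ is $\mathcal{T}$-closed for every $r\in L^0(\mathcal{F})$. For $x\in\mathrm{dom}(f)$, $\partial f(x)=\{u\in(E,\mathcal{T})^\ast:u(y-x)\le f(y)-f(x)\text{ for all }y\in E\}$. *)

(* Defs.v *)
From HB Require Import structures.
From mathcomp Require Import all_boot all_order all_algebra.
From mathcomp Require Import all_classical all_reals all_analysis.
From mathcomp Require Import measurable_realfun.
Set Implicit Arguments.
Unset Strict Implicit.
Unset Printing Implicit Defensive.
Import Order.TTheory GRing.Theory Num.Theory.
Import numFieldNormedType.Exports.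
Local Open Scope classical_set_scope.
Local Open Scope quotient_scope.
Local Open Scope ring_scope.

(* Elements are applied to points of Omega through a chosen representative, so
   every pointwise statement about them below is taken almost everywhere. *)
Definition L0 {d : measure_display} {Omega : measurableType d} {R : realType}
  (P : probability Omega R) : Type := {mfun_ P, Omega >-> R}.

Definition Lbar0 {d : measure_display} {Omega : measurableType d} {R : realType}
  (P : probability Omega R) : Type := {mfun_ P, Omega >-> \bar R}.

Definition L0_fun {d : measure_display} {Omega : measurableType d}
  {R : realType} {P : probability Omega R} (x : L0 P) : Omega -> R :=
  aqEqMfun_to_fun x.
Coercion L0_fun : L0 >-> Funclass.

Definition Lbar0_fun {d : measure_display} {Omega : measurableType d}
  {R : realType} {P : probability Omega R} (x : Lbar0 P) : Omega -> \bar R :=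
  aqEqMfun_to_fun x.
Coercion Lbar0_fun : Lbar0 >-> Funclass.

Section L0_ring.
Context {d : measure_display} {Omega : measurableType d} {R : realType}.
Variable P : probability Omega R.
Local Notation L0 := (L0 P).
Implicit Types x y z : L0.

HB.instance Definition _ := Choice.on L0.

Definition L0_class (f : {mfun Omega >-> R}) : L0 := \pi_({mfun_ P, Omega >-> R}) f.

Definition L0_repr (x : L0) : {mfun Omega >-> R} := repr x.

Lemma L0_classE (f : {mfun Omega >-> R}) :
  {ae P, forall w, L0_class f w = f w}.
Proof.
have /eqmodP/asboolP : L0_class f = \pi_({mfun_ P, Omega >-> R}) f by [].
have : repr (L0_class f) = f %[mod {mfun_ P, Omega >-> R}] by rewrite reprK.
by move=> /eqmodP/asboolP + _; apply: filterS => w; exact.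
Qed.

Lemma L0_ext x y : {ae P, forall w, x w = y w} -> x = y.
Proof.
move=> xy; rewrite -[x]reprK -[y]reprK; apply/eqmodP/asboolP.
by apply: filterS xy => w + _.
Qed.

Definition L0_zero : L0 := L0_class 0.
Definition L0_one : L0 := L0_class 1.
Definition L0_opp x : L0 := L0_class (- L0_repr x).
Definition L0_add x y : L0 := L0_class (L0_repr x + L0_repr y).
Definition L0_mul x y : L0 := L0_class (L0_repr x * L0_repr y).

Let zeroE : {ae P, forall w, L0_zero w = 0}.
Proof. exact: L0_classE. Qed.
Let oneE : {ae P, forall w, L0_one w = 1}.
Proof. exact: L0_classE. Qed.
Let oppE x : {ae P, forall w, L0_opp x w = - x w}.
Proof. exact: L0_classE. Qed.
Let addE x y : {ae P, forall w, L0_add x y w = x w + y w}.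
Proof. exact: L0_classE. Qed.
Let mulE x y : {ae P, forall w, L0_mul x y w = x w * y w}.
Proof. exact: L0_classE. Qed.

Let addA : associative L0_add.
Proof.
move=> x y z; apply: L0_ext.
near=> w.
have -> : L0_add x (L0_add y z) w = x w + L0_add y z w by near: w; exact: addE.
have -> : L0_add y z w = y w + z w by near: w; exact: addE.
have -> : L0_add (L0_add x y) z w = L0_add x y w + z w by near: w; exact: addE.
have -> : L0_add x y w = x w + y w by near: w; exact: addE.
exact: addrA.
Unshelve. all: by end_near. Qed.

Let addC : commutative L0_add.
Proof. by move=> x y; rewrite /L0_add addrC. Qed.

Let add0 : left_id L0_zero L0_add.
Proof.
move=> x; apply: L0_ext; near=> w.
have -> : L0_add L0_zero x w = L0_zero w + x w by near: w; exact: addE.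
have -> : L0_zero w = 0 by near: w; exact: zeroE.
exact: add0r.
Unshelve. all: by end_near. Qed.

Let addN : left_inverse L0_zero L0_opp L0_add.
Proof.
move=> x; apply: L0_ext; near=> w.
have -> : L0_add (L0_opp x) x w = L0_opp x w + x w by near: w; exact: addE.
have -> : L0_zero w = 0 by near: w; exact: zeroE.
have -> : L0_opp x w = - x w by near: w; exact: oppE.
exact: addNr.
Unshelve. all: by end_near. Qed.

HB.instance Definition _ := GRing.isZmodule.Build L0 addA addC add0 addN.

Let mulA : associative L0_mul.
Proof.
move=> x y z; apply: L0_ext.
near=> w.
have -> : L0_mul x (L0_mul y z) w = x w * L0_mul y z w by near: w; exact: mulE.
have -> : L0_mul y z w = y w * z w by near: w; exact: mulE.
have -> : L0_mul (L0_mul x y) z w = L0_mul x y w * z w by near: w; exact: mulE.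
have -> : L0_mul x y w = x w * y w by near: w; exact: mulE.
exact: mulrA.
Unshelve. all: by end_near. Qed.

Let mulC : commutative L0_mul.
Proof. by move=> x y; rewrite /L0_mul mulrC. Qed.

Let mul1 : left_id L0_one L0_mul.
Proof.
move=> x; apply: L0_ext; near=> w.
have -> : L0_mul L0_one x w = L0_one w * x w by near: w; exact: mulE.
have -> : L0_one w = 1 by near: w; exact: oneE.
exact: mul1r.
Unshelve. all: by end_near. Qed.

Let mulD : left_distributive L0_mul +%R.
Proof.
move=> x y z; apply: L0_ext; near=> w.
have -> : L0_mul (L0_add x y) z w = L0_add x y w * z w by near: w; exact: mulE.
have -> : L0_add x y w = x w + y w by near: w; exact: addE.
have -> : L0_add (L0_mul x z) (L0_mul y z) w = L0_mul x z w + L0_mul y z w.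
  by near: w; exact: addE.
have -> : L0_mul x z w = x w * z w by near: w; exact: mulE.
have -> : L0_mul y z w = y w * z w by near: w; exact: mulE.
exact: mulrDl.
Unshelve. all: by end_near. Qed.

Let one_neq0 : L0_one != 0.
Proof.
apply/eqP => h.
have [w /eqP] : exists w : Omega, (1 : R) = 0.
  have PF : ProperFilter (almost_everywhere P).
    by apply: ae_properfilter_algebraOfSetsType; rewrite [ltRHS]probability_setT.
  apply: (@filter_ex _ (almost_everywhere P)).
  near=> w; transitivity (L0_one w); first by apply/esym; near: w; exact: oneE.
  by rewrite h; near: w; exact: zeroE.
by rewrite oner_eq0.
Unshelve. all: by end_near. Qed.

HB.instance Definition _ :=
  GRing.Zmodule_isComNzRing.Build L0 mulA mulC mul1 mulD one_neq0.

Lemma L0_0E : {ae P, forall w, (0 : L0) w = 0}. Proof. exact: zeroE. Qed.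
Lemma L0_1E : {ae P, forall w, (1 : L0) w = 1}. Proof. exact: oneE. Qed.
Lemma L0_NE x : {ae P, forall w, (- x : L0) w = - x w}. Proof. exact: oppE. Qed.
Lemma L0_DE x y : {ae P, forall w, (x + y : L0) w = x w + y w}.
Proof. exact: addE. Qed.
Lemma L0_ME x y : {ae P, forall w, (x * y : L0) w = x w * y w}.
Proof. exact: mulE. Qed.

Definition L0_indic (A : set Omega) (mA : measurable A) : L0 :=
  L0_class (indic_mfun A mA).

Definition L0_pp x : Prop := {ae P, forall w, 0 < x w}.

Definition L0_unit_interval x : Prop := {ae P, forall w, 0 <= x w <= 1}.

Definition L0_norm_le x y : Prop := {ae P, forall w, `|x w| <= y w}.

(* The topology T_c of L0, finer than that of convergence in probability. *)
Definition L0_nbhs x : set_system L0 :=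
  filter_from L0_pp (fun eps => [set y | L0_norm_le (y - x) eps]).

Let nbhs_filter x : ProperFilter (L0_nbhs x).
Proof.
apply: filter_from_proper; last first.
  move=> eps eps0; exists x; rewrite /= /L0_norm_le subrr.
  near=> w; have -> : (0 : L0) w = 0 by near: w; exact: L0_0E.
  by rewrite normr0 ltW//; near: w.
apply: filter_from_filter.
  by exists 1; near=> w; have -> : (1 : L0) w = 1 by near: w; exact: L0_1E.
move=> e1 e2 e1_gt0 e2_gt0.
pose e := L0_class (min_mfun (L0_repr e1) (L0_repr e2)).
have eE : {ae P, forall w, e w = Num.min (e1 w) (e2 w)} by exact: L0_classE.
exists e.
  near=> w; have -> : e w = Num.min (e1 w) (e2 w) by near: w.
  by rewrite lt_min; apply/andP; split; near: w.
move=> y ye; split; near=> w.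
- have : `|(y - x : L0) w| <= e w by near: w.
  have -> : e w = Num.min (e1 w) (e2 w) by near: w.
  by rewrite le_min => /andP[].
- have : `|(y - x : L0) w| <= e w by near: w.
  have -> : e w = Num.min (e1 w) (e2 w) by near: w.
  by rewrite le_min => /andP[].
Unshelve. all: by end_near. Qed.

Let nbhs_singleton x (A : set L0) : L0_nbhs x A -> A x.
Proof.
move=> [e e0]; apply; rewrite /= /L0_norm_le subrr.
near=> w; have -> : (0 : L0) w = 0 by near: w; exact: L0_0E.
by rewrite normr0 ltW//; near: w.
Unshelve. all: by end_near. Qed.

Let nbhs_nbhs x (A : set L0) : L0_nbhs x A -> L0_nbhs x (L0_nbhs^~ A).
Proof.
move=> [e e0 xeA].
pose h : L0 := L0_class (cst 2^-1 : {mfun Omega >-> R}) * e.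
have hE : {ae P, forall w, h w = 2^-1 * e w}.
  near=> w.
  have -> : h w = L0_class (cst 2^-1 : {mfun Omega >-> R}) w * e w.
    by near: w; exact: L0_ME.
  by congr (_ * _); near: w; exact: L0_classE.
have h0 : L0_pp h.
  near=> w; have -> : h w = 2^-1 * e w by near: w.
  by rewrite mulr_gt0 ?invr_gt0//; near: w.
exists h => // y xy; exists h => // z yz; apply: xeA => /=.
rewrite /= in xy yz; near=> w.
have -> : z - x = (z - y) + (y - x) by rewrite addrA subrK.
have -> : (z - y + (y - x) : L0) w = (z - y : L0) w + (y - x : L0) w.
  by near: w; exact: L0_DE.
have -> : e w = h w + h w.
  have -> : h w = 2^-1 * e w by near: w.
  by rewrite -mulrDl -div1r -splitr mul1r.
by rewrite (le_trans (ler_normD _ _))// lerD//; near: w.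
Unshelve. all: by end_near. Qed.

HB.instance Definition _ := hasNbhs.Build L0 L0_nbhs.
HB.instance Definition _ :=
  Nbhs_isNbhsTopological.Build L0 nbhs_filter nbhs_singleton nbhs_nbhs.

End L0_ring.

Section L0_module.
Context {d : measure_display} {Omega : measurableType d} {R : realType}.
Context {P : probability Omega R}.
Variable E : lmodType (L0 P).
Implicit Types (B G : set E) (A : nat -> set Omega).

(* Some of the A n may be empty, so finite partitions are included. *)
Definition countable_partition A : Prop :=
  trivIset [set: nat] A /\ \bigcup_n A n = [set: Omega].

Definition concatenation_separated : Prop :=
  forall A (mA : forall n, measurable (A n)), countable_partition A ->
  forall x y : E,
    (forall n, L0_indic P (mA n) *: x = L0_indic P (mA n) *: y) -> x = y.

Definition countable_concatenation G : Prop :=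
  forall A (mA : forall n, measurable (A n)), countable_partition A ->
  forall x_ : nat -> E, (forall n, G (x_ n)) ->
  exists2 x, G x &
    forall n, L0_indic P (mA n) *: x = L0_indic P (mA n) *: x_ n.

Definition L0_balanced B : Prop :=
  forall eta : L0 P, L0_norm_le eta 1 -> forall x, B x -> B (eta *: x).

Definition L0_convex B : Prop :=
  forall x y, B x -> B y ->
  forall xi : L0 P, L0_unit_interval xi -> B (xi *: x + (1 - xi) *: y).

Definition L0_absorbent B : Prop :=
  forall x, exists2 xi : L0 P, L0_pp xi &
    forall eta : L0 P, L0_norm_le eta xi -> B (eta *: x).

End L0_module.
Arguments concatenation_separated {d Omega R P} E.

(* An L0-module together with a topology on it. A join of Topological and
   GRing.Lmodule (L0 P) cannot be declared as an HB structure: the library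
   already has such joins, over numDomainType scalars only. *)
Record topL0Module {d : measure_display} {Omega : measurableType d}
    {R : realType} (P : probability Omega R) := TopL0Module {
  topL0_lmod : lmodType (L0 P) ;
  topL0_open : set_system topL0_lmod ;
  topL0_openT : topL0_open setT ;
  topL0_openI : setI_closed topL0_open ;
  topL0_open_bigU : forall (I : Type) (F : I -> set topL0_lmod),
    (forall i, topL0_open (F i)) -> topL0_open (\bigcup_i F i)
}.

Definition topL0_sort {d : measure_display} {Omega : measurableType d}
  {R : realType} {P : probability Omega R} (E : topL0Module P) : Type :=
  topL0_lmod E.
Coercion topL0_sort : topL0Module >-> Sortclass.

Section topL0Module_instances.
Context {d : measure_display} {Omega : measurableType d} {R : realType}.
Context {P : probability Omega R}.
Variable E : topL0Module P.

HB.instance Definition _ := GRing.Lmodule.copy (topL0_sort E) (topL0_lmod E).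
HB.instance Definition _ := isOpenTopological.Build (topL0_sort E)
  (@topL0_openT _ _ _ _ E) (@topL0_openI _ _ _ _ E)
  (@topL0_open_bigU _ _ _ _ E).

End topL0Module_instances.

Section L0_functions.
Context {d : measure_display} {Omega : measurableType d} {R : realType}.
Context {P : probability Omega R}.
Variable E : topL0Module P.
Implicit Types (B : set E) (f : E -> Lbar0 P).

(* The topology is not required to be Hausdorff. *)
Definition locally_L0_convex : Prop :=
  [/\ continuous (fun z : E * E => z.1 + z.2),
      continuous (fun z : L0 P * E => z.1 *: z.2) &
      exists2 B : set (set E),
        (forall U, B U -> [/\ L0_balanced U, L0_absorbent U & L0_convex U]) &
        nbhs (0 : E) = filter_from B id].

Definition L0_barrel B : Prop :=
  [/\ L0_balanced B, L0_absorbent B, L0_convex B & closed B].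

Definition L0_pre_barreled : Prop :=
  locally_L0_convex /\
  forall B, L0_barrel B -> countable_concatenation B -> nbhs (0 : E) B.

Definition L0_dom f : set E := [set x | {ae P, forall w, (f x w < +oo)%E}].

Definition L0_proper f : Prop :=
  L0_dom f !=set0 /\ forall x, {ae P, forall w, (-oo < f x w)%E}.

(* The dual addition of extended reals implements +oo + -oo = +oo. *)
Definition L0_convex_fun f : Prop :=
  forall (x y : E) (xi : L0 P), L0_unit_interval xi ->
  {ae P, forall w, (f (xi *: x + (1 - xi) *: y)%R w <=
    ((xi w)%:E * f x w + (((1 - xi)%R : L0 P) w)%:E * f y w)%dE)%E}.

Definition L0_lower_semicontinuous f : Prop :=
  forall r : L0 P, closed [set x | {ae P, forall w, (f x w <= (r w)%:E)%E}].

(* Library linear forms over L0 P are exactly the module homomorphisms. *)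
Definition L0_subdifferential f (x : E) : set {scalar E} :=
  [set u : {scalar E} | continuous (u : E -> L0 P) /\
    forall y, {ae P, forall w,
      (((u (y - x)%R : L0 P) w)%:E <= (f y w - f x w)%dE)%E}].

End L0_functions.
Arguments locally_L0_convex {d Omega R P} E.
Arguments L0_pre_barreled {d Omega R P} E.

(* Main.v *)
(* A module analogue of the classical argument: f is bounded above on a barrel
   around x, and a Hahn-Banach separation from the epigraph gives the
   subgradient. With c = f x, let C be the set of (y, s) in E x L0 with
   f (x + y) <= c + s; working with this real-valued epigraph avoids extended
   values throughout. The set of y with both y and - y in the sublevel
   C (., 1) is a closed L0-barrel, and it inherits the countable concatenation
   property from E because an L0-convex function is local: on an event A the
   value f y only depends on the restriction of y to A. Pre-barreledness makes
   it a neighborhood of 0.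
   For Hahn-Banach, take by Zorn's lemma a maximal submodule G of E x L0 that
   lies below C. Such a G is automatically the graph of a function: a pair
   (0, r) in G gives (0, r ^ 2) in G, whence r ^ 2 <= 0. To extend G to L0 x,
   it suffices to find a slope compatible with the multiples t x, t > 0 a.s. and
   t < 0 a.s.; it exists because L0 is Dedekind complete, and a general multiple
   xi x is handled by gluing along the events xi > 0, xi = 0 and xi < 0. *)
Require Import Defs.
From HB Require Import structures.
From mathcomp Require Import all_boot all_order all_algebra.
From mathcomp Require Import all_classical all_reals all_analysis.
From mathcomp Require Import measurable_realfun.
From mathcomp Require Import ring lra.
Import Order.TTheory GRing.Theory Num.Theory DualAddTheory.
Import numFieldNormedType.Exports.
Set Implicit Arguments.
Unset Strict Implicit.
Unset Printing Implicit Defensive.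
Local Open Scope classical_set_scope.
Local Open Scope ring_scope.

(** * Order structure of L0 *)

(* Rewrites the ring operations of L0 at a generic point w (introduced by
   near=>) into those of R. *)
Ltac pw_step w :=
  match goal with
  | |- context [@L0_fun ?d ?O ?R ?P ?z w] =>
    let H := fresh in
    match z with
    | (?x + ?y)%R => assert (H : L0_fun z w = L0_fun x w + L0_fun y w)
        by (near: w; exact: (L0_DE x y))
    | (- ?x)%R => assert (H : L0_fun z w = - L0_fun x w)
        by (near: w; exact: (L0_NE x))
    | (?x * ?y)%R => assert (H : L0_fun z w = L0_fun x w * L0_fun y w)
        by (near: w; exact: (L0_ME x y))
    | 0%R => assert (H : L0_fun z w = 0) by (near: w; exact: (L0_0E P))
    | 1%R => assert (H : L0_fun z w = 1) by (near: w; exact: (L0_1E P))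
    end; rewrite H; clear H
  end.
Ltac pw w := repeat (pw_step w).

Section L0_order.
Context {d : measure_display} {Omega : measurableType d} {R : realType}.
Context {P : probability Omega R}.
Implicit Types (x y z t : L0 P) (A : set Omega).

Definition L0_le x y : Prop := {ae P, forall w, x w <= y w}.

Lemma L0_norm_le_refl t : L0_pp t -> L0_norm_le t t.
Proof. by apply: filterS => w tw; rewrite ger0_norm// ltW. Qed.

Lemma measurable_L0 x : measurable_fun setT x.
Proof. exact: measurable_funPT. Qed.

Lemma L0_lift (h : Omega -> R) : measurable_fun setT h ->
  exists x, {ae P, forall w, x w = h w}.
Proof.
move=> mh; pose m := isMeasurableFun.Build _ _ _ _ h mh.
pose f : {mfun Omega >-> R} := HB.pack h m.
by exists (L0_class P f); exact: L0_classE.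
Qed.

Lemma L0_inv t : L0_pp t -> exists2 v : L0 P, t * v = 1 & L0_pp v.
Proof.
move=> t0; have [|v vE] := @L0_lift (fun w => powR (t w) (-1)).
  apply: (measurableT_comp (measurable_powR _)); exact: measurable_L0.
exists v; last first.
  near=> w; have -> : v w = powR (t w) (-1) by near: w.
  by rewrite powR_gt0//; near: w.
apply: L0_ext; near=> w; pw w.
have -> : v w = powR (t w) (-1) by near: w.
have tw : 0 < t w by near: w.
by rewrite powR_inv1 ?ltW// mulfV ?gt_eqF.
Unshelve. all: by end_near. Qed.

Lemma L0_indicE A (mA : measurable A) :
  {ae P, forall w, L0_indic P mA w = \1_A w}.
Proof. exact: L0_classE. Qed.

Lemma L0_indic_unit A (mA : measurable A) : L0_unit_interval (L0_indic P mA).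
Proof.
near=> w; have -> : L0_indic P mA w = \1_A w by near: w; exact: L0_indicE.
by rewrite indicE; case: (_ \in _) => /=; rewrite ?lexx ler01.
Unshelve. all: by end_near. Qed.

Lemma L0_sup (b : nat -> L0 P) z : (forall n, L0_le (b n) z) ->
  exists a, (forall n, L0_le (b n) a) /\
    forall y, (forall n, L0_le (b n) y) -> L0_le a y.
Proof.
(* Truncation at [z] changes [b n] only on a null set and keeps the supremum finite at every [w]. *)
move=> bz; pose h n w := Num.min (b n w) (z w).
have hz w n : h n w <= z w by rewrite ge_min lexx orbT.
have hub w : has_ubound (range (h^~ w)) by exists (z w) => _ [n _ <-].
have [|a aE] := @L0_lift (fun w => sups (h^~ w) 0).
  apply: measurable_fun_sups => // n.
  by apply: measurable_minr; exact: measurable_L0.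
have supE w : sups (h^~ w) 0 = sup (range (h^~ w)).
  by congr sup; apply/seteqP; split=> [_ [n _ <-]|_ [n _ <-]]; exists n.
exists a; split=> [n|y by_].
  near=> w; have -> : a w = sups (h^~ w) 0 by near: w.
  have <- : h n w = b n w.
    by rewrite /h; apply/min_idPl; near: w; exact: bz.
  by rewrite supE ub_le_sup//; exists n.
have {}by_ : {ae P, forall w, forall n, b n w <= y w} by exact/ae_foralln.
near=> w; have -> : a w = sups (h^~ w) 0 by near: w.
rewrite supE; apply: ge_sup; first by exists (h 0%N w); exists 0%N.
move=> _ [n _ <-]; rewrite ge_min; apply/orP; left.
by move: n; near: w.
Unshelve. all: by end_near. Qed.

(* The integral of the bounded strictly increasing function atan turns
   domination in S into a real-valued maximisation. *)
Lemma L0_maximum (S : set (L0 P)) : S !=set0 ->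
  (forall b : nat -> L0 P, (forall n, S (b n)) ->
    exists2 a, S a & forall n, L0_le (b n) a) ->
  exists2 a, S a & forall b, S b -> L0_le b a.
Proof.
move=> [b0 Sb0] Sdir.
pose phi x := (\int[P]_w (@atan R (x w)))%R.
have matan x : measurable_fun setT (fun w => @atan R (x w)).
  apply: measurableT_comp; last exact: measurable_L0.
  by apply: continuous_measurable_fun => r; exact: continuous_atan.
have iatan x : P.-integrable setT (EFin \o (fun w => @atan R (x w))).
  apply: measurable_bounded_integrable => //.
    by rewrite [ltLHS]probability_setT ltry.
  exists (pi / 2); split; first exact: num_real.
  move=> r pr w _ /=; rewrite (le_trans _ (ltW pr))// ler_norml.
  by rewrite !ltW ?atan_gtNpi2 ?atan_ltpi2.
(* For [x <= y] the L1 distance of the arctangents is the difference of the integrals, so equal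
   integrals force [x = y]. *)
have phi_dist x y : L0_le x y ->
    (\int[P]_w `|(atan (y w) - atan (x w))%:E| = (phi y - phi x)%:E)%E.
  move=> xy; rewrite -RintegralB//= /Rintegral fineK; last first.
    apply: integrable_fin_num => //.
    exact: (integrableB measurableT (iatan y) (iatan x)).
  apply: ae_eq_integral => //.
  - apply/measurable_EFinP; apply: measurableT_comp => //.
    exact: measurable_funB.
  - by apply/measurable_EFinP; exact: measurable_funB.
  near=> w => _; rewrite /= ger0_norm// subr_ge0 le_atan//.
  by near: w.
have phi_le x y : L0_le x y -> phi x <= phi y.
  move=> xy; rewrite -subr_ge0 -lee_fin -phi_dist//.
  exact: integral_ge0.
have phi_eq x y : L0_le x y -> phi y <= phi x -> L0_le y x.
  move=> xy yx; have := phi_dist _ _ xy.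
  have -> : phi y - phi x = 0.
    by apply/eqP; rewrite subr_eq0 eq_le yx phi_le.
  move/ae_eq_integral_abs => H.
  have {H} : ae_eq P setT (fun w => (atan (y w) - atan (x w))%:E) (cst 0%E).
    apply: H => //; apply/measurable_EFinP; exact: measurable_funB.
  move=> H; apply: filterS H => w /(_ I) /= [] /eqP.
  by rewrite subr_eq0 => /eqP/(can_inj (@atanK R)) ->.
have phi_ub x : phi x <= pi / 2.
  have -> : pi / 2 = \int[P]_w (cst (pi / 2 : R) w).
    by rewrite Rintegral_cst//= [fine _](_ : _ = 1) ?mulr1// probability_setT.
  apply: le_Rintegral => //=; first by exact: finite_measure_integrable_cst.
  by move=> w _; rewrite ltW ?atan_ltpi2.
have supJ : has_sup (phi @` S).
  by split; [exists (phi b0), b0|exists (pi / 2) => _ [x _ <-]].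
(* A maximising sequence for [phi]; an element of [S] dominating it attains the supremum. *)
have /choice[b bP] (n : nat) :
    exists x, S x /\ sup (phi @` S) - n.+1%:R^-1 < phi x.
  have [|_ [x Sx <-] xJ] := @sup_adherent _ (phi @` S) n.+1%:R^-1 _ supJ.
    by rewrite invr_gt0.
  by exists x.
have [a Sa ba] := Sdir b (fun n => (bP n).1).
have supa : sup (phi @` S) <= phi a.
  apply/ler_addgt0Pr => e e0.
  have [n ne] : exists n : nat, n.+1%:R^-1 < e.
    by have /ltr_add_invr[n] := e0; rewrite add0r; exists n.
  rewrite -lerBlDr (le_trans _ (phi_le _ _ (ba n)))//.
  by rewrite (le_trans _ (ltW (bP n).2))// lerD2l lerN2 ltW.
exists a => // x Sx.
(* This [c] lies above both [a] and [x], while [phi c <= phi a] forces [c <= a]. *)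
have [c Sc cP] := Sdir (fun n => if n is 0%N then a else x)
  (fun n => if n is 0%N then Sa else Sx).
have ca : L0_le c a.
  apply: phi_eq; first exact: (cP 0%N).
  by rewrite (le_trans _ supa)// ub_le_sup//; exact: supJ.2.
move: (cP 1%N) ca => /=; apply: filterS2 => w xc; exact: (le_trans xc).
Unshelve. all: by end_near. Qed.

End L0_order.

(* Keeps unification from unfolding ring operations to representatives. *)
#[local] Opaque L0_add L0_mul L0_opp L0_zero L0_one.

(** * Hahn-Banach separation over L0 *)

Section hahn_banach.
Context {d : measure_display} {Omega : measurableType d} {R : realType}.
Context {P : probability Omega R}.
Variables (E : lmodType (L0 P)) (C : E -> L0 P -> Prop).
Hypothesis C_convex : forall y y' s s' xi, L0_unit_interval xi ->
  C y s -> C y' s' -> C (xi *: y + (1 - xi) *: y') (xi * s + (1 - xi) * s').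
Hypothesis C00 : C 0 0.
Hypothesis C0_ge0 : forall r, C 0 r -> L0_le 0 r.
Hypothesis C_absorbent : forall x, exists t s, L0_pp t /\ C (t *: x) s.
Implicit Types (G : set (E * L0 P)) (x y m : E) (a b r s t v xi : L0 P).

(** Submodules encoded as relations. The empty one is allowed, since the union of an empty chain
    must qualify in Zorn's lemma. *)
Definition linear_graph G := forall a m m' r r',
  G (m, r) -> G (m', r') -> G (a *: m + m', a * r + r').

Definition graph_below G := forall m r s, G (m, r) -> C m s -> L0_le r s.

(** Only strictly positive multiples of [x] are tested; negative ones are covered by the same
    condition for [- x] and [- b]. *)
Definition slope_below G x b := forall m r t s,
  G (m, r) -> L0_pp t -> C (m + t *: x) s -> L0_le (r + t * b) s.

(** * Extension of a graph by one element *)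

Section one_step.
Variables (G : set (E * L0 P)) (Glin : linear_graph G) (Gle : graph_below G).
Hypothesis G00 : G (0, 0).

Let Gscale a m r : G (m, r) -> G (a *: m, a * r).
Proof. by move=> Gm; have := Glin a Gm G00; rewrite !addr0. Qed.

(** Division-free form of [(r' - s') / t' <= (s - r) / t]. The convex combination with weights
    [t' / (t + t')] and [t / (t + t')] cancels the multiples of [x], so that [Gle] applies. *)
Let opposite_slopes x m r t s m' r' t' s' :
  G (m, r) -> L0_pp t -> C (m + t *: x) s ->
  G (m', r') -> L0_pp t' -> C (m' + t' *: (- x)) s' ->
  L0_le (t' * r + t * r') (t' * s + t * s').
Proof.
move=> Gm t0 Cs Gm' t'0 Cs'.
have [|v vE v0] := @L0_inv _ _ _ P (t + t').
  by near=> w; pw w; rewrite addr_gt0//; near: w.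
pose xi := t' * v; have xiE : 1 - xi = t * v by rewrite -vE /xi mulrDl addrK.
have xi_unit : L0_unit_interval xi.
  near=> w.
  have : (1 - xi : L0 P) w = (t * v : L0 P) w by rewrite xiE.
  rewrite /xi; pw w.
  have vw : 0 < v w by near: w.
  have tw : 0 < t w by near: w.
  have t'w : 0 < t' w by near: w.
  have := mulr_ge0 (ltW t'w) (ltW vw); have := mulr_ge0 (ltW tw) (ltW vw).
  lra.
have := C_convex xi_unit Cs Cs'.
have -> : xi *: (m + t *: x) + (1 - xi) *: (m' + t' *: - x) =
    xi *: m + (1 - xi) *: m'.
  rewrite !scalerDr !scalerA xiE scalerN addrACA.
  rewrite [X in _ + (_ - X)](_ : _ = xi * t *: x).
    by rewrite subrr addr0.
  by congr (_ *: _); rewrite /xi [RHS]mulrC [t' * v]mulrC mulrA.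
move=> /(Gle (Glin xi Gm (Gscale (1 - xi) Gm'))) H; rewrite xiE /xi in H.
near=> w.
have : (t' * v * r + t * v * r' : L0 P) w <= (t' * v * s + t * v * s' : L0 P) w.
  by near: w.
pw w.
have vw : 0 < v w by near: w.
by move=> H1; rewrite -(ler_pM2l vw); lra.
Unshelve. all: by end_near. Qed.

(** A constraint in direction [- x] bounds the slope from below, and by [opposite_slopes] that bound
    itself lies in [slope_below G x]. The greatest element of this set thus meets both kinds of
    constraints. *)
Let slope_max x : exists a, slope_below G x a /\ slope_below G (- x) (- a).
Proof.
have lower m r t s v : G (m, r) -> L0_pp t -> C (m + t *: (- x)) s ->
    t * v = 1 -> L0_pp v -> slope_below G x (v * (r - s)).
  move=> Gm t0 Cs tv v0 m' r' t' s' Gm' t'0 Cs'.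
  have H := opposite_slopes Gm' t'0 Cs' Gm t0 Cs.
  near=> w; pw w.
  have : (t * v : L0 P) w = (1 : L0 P) w by rewrite tv.
  have : (t * r' + t' * r : L0 P) w <= (t * s' + t' * s : L0 P) w by near: w.
  pw w.
  have vw : 0 < v w by near: w.
  move=> H1 H2; move: H1; rewrite -(ler_pM2l vw) => H1.
  have -> : r' w = v w * (t w * r' w) by rewrite mulrA [v w * _]mulrC H2 mul1r.
  have -> : s' w = v w * (t w * s' w) by rewrite mulrA [v w * _]mulrC H2 mul1r.
  lra.
have Sne : slope_below G x !=set0.
  have [t [s [t0 Cs]]] := C_absorbent (- x).
  have [v vE v0] := L0_inv t0.
  exists (v * (0 - s)); apply: (lower 0 0 t s v G00 t0 _ vE v0).
  by rewrite add0r.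
have le_div r t s v b : t * v = 1 -> L0_pp t -> L0_pp v ->
    L0_le (r + t * b) s <-> L0_le b (v * (s - r)).
  move=> tv t0 v0; split => H; near=> w.
    have : (t * v : L0 P) w = (1 : L0 P) w by rewrite tv.
    have : (r + t * b : L0 P) w <= s w by near: w.
    pw w; have vw : 0 < v w by near: w.
    move=> H1 H2.
    have -> : b w = v w * (t w * b w) by rewrite mulrA [v w * _]mulrC H2 mul1r.
    by rewrite ler_pM2l//; lra.
  have : (t * v : L0 P) w = (1 : L0 P) w by rewrite tv.
  have : b w <= (v * (s - r) : L0 P) w by near: w.
  pw w; have tw : 0 < t w by near: w.
  by rewrite -(ler_pM2l tw) mulrA => + H2; rewrite H2; lra.
(* Absorbency gives a point [t *: x] whose constraint bounds all admissible slopes. A least upper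
   bound of a sequence of them stays admissible, as every constraint is an upper bound. *)
have [|a Sa amax] := L0_maximum Sne.
  move=> b Sb.
  have [t [s [t0 Cs]]] := C_absorbent x.
  have [v vE v0] := L0_inv t0.
  have [|a [ba aP]] := @L0_sup _ _ _ P b (v * (s - 0)).
    move=> n; apply/(le_div _ _ _ _ _ vE) => //.
    by apply: (Sb n _ _ _ _ G00 t0); rewrite add0r.
  exists a => // m r t' s' Gm t'0 Cs'.
  have [v' v'E v'0] := L0_inv t'0.
  apply/(le_div _ _ _ _ _ v'E) => //; apply: aP => n.
    apply/(le_div _ _ _ _ _ v'E) => //; exact: (Sb n m r t' s').
exists a; split=> // m r t s Gm t0 Cs.
have [v vE v0] := L0_inv t0.
have /amax H := lower m r t s v Gm t0 Cs vE v0.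
apply/(le_div _ _ _ _ _ vE) => //.
near=> w; have : (v * (r - s) : L0 P) w <= a w by near: w.
by pw w; lra.
Unshelve. all: by end_near. Qed.

(** Off the event [xi > 0] the coefficient is replaced by a positive [t1] given by absorbency. The
    slope condition applies to the new coefficient and is then read on the event. *)
Let slope_below_gt0 x a m r xi s : slope_below G x a -> G (m, r) ->
  C (m + xi *: x) s -> {ae P, forall w, 0 < xi w -> r w + xi w * a w <= s w}.
Proof.
move=> Sa Gm Cs.
have mA : measurable [set w | 0 < xi w].
  have := @measurable_L0 _ _ _ P xi measurableT
    [set` `]0, +oo[ ] (measurable_itv _).
  rewrite setTI; congr (measurable _); apply/seteqP.
  by split=> w /=; rewrite in_itv/= andbT.
pose i := L0_indic P mA.
have iE : {ae P, forall w, i w = \1_[set w | 0 < xi w] w} := L0_indicE mA.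
have [t1 [s1 [t10 Cs1]]] := C_absorbent x.
have := C_convex (L0_indic_unit mA) Cs Cs1; rewrite -/i.
have -> : i *: (m + xi *: x) + (1 - i) *: (t1 *: x) =
    i *: m + (i * xi + (1 - i) * t1) *: x.
  by rewrite scalerDr !scalerA -addrA -scalerDl.
move=> /(Sa _ _ _ _ (Gscale i Gm)) H.
have {}/H H : L0_pp (i * xi + (1 - i) * t1).
  near=> w; pw w.
  have -> : i w = \1_[set w | 0 < xi w] w by near: w.
  have t1w : 0 < t1 w by near: w.
  by rewrite indicE; case: (boolP (_ \in _)) => [/set_mem/=|_] /=; lra.
near=> w => xi0.
have : (i * r + (i * xi + (1 - i) * t1) * a : L0 P) w <=
  (i * s + (1 - i) * s1 : L0 P) w by near: w.
pw w; have -> : i w = \1_[set w | 0 < xi w] w by near: w.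
by rewrite indicE mem_set//=; lra.
Unshelve. all: by end_near. Qed.

(** Multiplication by the indicator of the event [xi = 0] removes the multiple of [x], so [Gle]
    applies. *)
Let below_eq0 x m r xi s : G (m, r) ->
  C (m + xi *: x) s -> {ae P, forall w, xi w = 0 -> r w <= s w}.
Proof.
move=> Gm Cs.
have mA : measurable [set w | xi w = 0].
  have := @measurable_L0 _ _ _ P xi measurableT [set 0] (measurable_set1 _).
  by rewrite setTI.
pose i := L0_indic P mA.
have iE : {ae P, forall w, i w = \1_[set w | xi w = 0] w} := L0_indicE mA.
have := C_convex (L0_indic_unit mA) Cs C00; rewrite -/i.
have ixi : i * xi = 0.
  apply: L0_ext; near=> w; pw w.
  have -> : i w = \1_[set w | xi w = 0] w by near: w.
  by rewrite indicE; case: (boolP (_ \in _)) => [/set_mem/= ->|_] /=; lra.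
rewrite scaler0 addr0 mulr0 addr0 scalerDr scalerA ixi scale0r addr0.
move=> /(Gle (Gscale i Gm)) H; near=> w => xi0.
have : (i * r : L0 P) w <= (i * s : L0 P) w by near: w.
pw w; have -> : i w = \1_[set w | xi w = 0] w by near: w.
by rewrite indicE mem_set//=; lra.
Unshelve. all: by end_near. Qed.

Lemma one_step_extension x : exists a, forall m r xi s,
  G (m, r) -> C (m + xi *: x) s -> L0_le (r + xi * a) s.
Proof.
have [a [Sa SNa]] := slope_max x; exists a => m r xi s Gm Cs.
have Hp := slope_below_gt0 Sa Gm Cs.
have Hn : {ae P, forall w, 0 < (- xi : L0 P) w ->
    r w + (- xi : L0 P) w * (- a : L0 P) w <= s w}.
  by apply: (slope_below_gt0 SNa Gm); rewrite scaleNr scalerN opprK.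
have H0 := below_eq0 Gm Cs.
near=> w; pw w.
have hp : 0 < xi w -> r w + xi w * a w <= s w by near: w.
have hn : 0 < (- xi : L0 P) w ->
    r w + (- xi : L0 P) w * (- a : L0 P) w <= s w by near: w.
have h0 : xi w = 0 -> r w <= s w by near: w.
move: hn; pw w; rewrite oppr_gt0 mulrNN.
have [||/esym] := ltrgtP 0 (xi w) => [/hp//|? -> //|x0 _].
by rewrite x0 mul0r addr0 h0.
Unshelve. all: by end_near. Qed.

End one_step.

(** * Maximal graphs and the separating linear form *)

Lemma graph_functional G m r r' : linear_graph G -> graph_below G ->
  G (m, r) -> G (m, r') -> r = r'.
Proof.
move=> Glin Gle Gm Gm'.
have G0 : G (0, r - r').
  by have := Glin (-1) _ _ _ _ Gm' Gm; rewrite scaleN1r addNr mulN1r addrC.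
have G00 : G (0, 0).
  by have := Glin (-1) _ _ _ _ Gm Gm; rewrite scaleN1r addNr mulN1r addNr.
have Gsq : G (0, (r - r') * (r - r')).
  by have := Glin (r - r') _ _ _ _ G0 G00; rewrite scaler0 !addr0.
have sq_le0 := Gle _ _ _ Gsq C00.
apply: L0_ext; near=> w.
have : ((r - r') * (r - r') : L0 P) w <= (0 : L0 P) w by near: w.
pw w => sq0; apply/eqP; rewrite -subr_eq0 -sqrf_eq0 eq_le sqr_ge0 andbT.
by rewrite expr2.
Unshelve. all: by end_near. Qed.

Lemma maximal_graph_total G : linear_graph G -> graph_below G -> G !=set0 ->
  (forall G', linear_graph G' -> graph_below G' -> ~ G `<` G') ->
  forall x, exists a, G (x, a).
Proof.
move=> Glin Gle [[m0 r0] Gm0] Gmax x.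
have G00 : G (0, 0).
  by have := Glin (-1) _ _ _ _ Gm0 Gm0; rewrite scaleN1r addNr mulN1r addNr.
have [a aP] := one_step_extension Glin Gle G00 x.
apply: contrapT => xnG.
(* The submodule generated by [G] and [(x, a)], strictly larger because it contains that pair. *)
pose G' := [set z : E * L0 P | exists m r xi,
  [/\ G (m, r), z.1 = m + xi *: x & z.2 = r + xi * a]].
apply: (Gmax G').
- move=> c _ _ _ _ [m [r [xi [Gm /= -> ->]]]] [m' [r' [xi' [Gm' /= -> ->]]]].
  exists (c *: m + m'), (c * r + r'), (c * xi + xi'); split.
  + exact: Glin.
  + by rewrite /= scalerDr scalerA addrACA -scalerDl.
  + by rewrite /= mulrDr mulrA addrACA -mulrDl.
- move=> _ _ s [m [r [xi [Gm /= -> ->]]]] Cs.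
  exact: aP Gm Cs.
- split.
    move=> [m r] Gm; exists m, r, 0.
    by split=> //; rewrite ?scale0r ?mul0r addr0.
  move=> /(_ (x, a)) G'G; apply: xnG; exists a; apply: G'G.
  by exists 0, 0, 1; split=> //; rewrite ?scale1r ?mul1r add0r.
Qed.

Lemma L0_hahn_banach : exists u : {scalar E},
  forall y s, C y s -> L0_le (u y) s.
Proof.
have [|G [[Glin Gle] Gmax]] :=
    @Zorn_bigcup _ [set G | linear_graph G /\ graph_below G].
  move=> F FP Ftot; split.
    move=> c m m' r r' [X FX Xm] [Y FY Ym'].
    have [XY|YX] := Ftot _ _ FX FY.
      by exists Y => //; apply: (FP _ FY).1 => //; exact: XY.
    by exists X => //; apply: (FP _ FX).1 => //; exact: YX.
  by move=> m r s [X FX Xm]; exact: (FP _ FX).2.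
have {}Gmax G' : linear_graph G' -> graph_below G' -> ~ G `<` G'.
  by move=> G'lin G'le GG'; exact: (Gmax G').
(* The empty graph is not maximal: the zero graph strictly contains it. *)
have Gne : G !=set0.
  apply/set0P/negP => /eqP G0; apply: (Gmax [set (0, 0)]).
  - by move=> c _ _ _ _ [-> ->] [-> ->]; rewrite scaler0 mulr0 !addr0.
  - by move=> _ _ s [-> ->]; exact: C0_ge0.
  - by rewrite G0; split=> // /(_ (0, 0)); exact.
have /choice[u uP] := maximal_graph_total Glin Gle Gne Gmax.
have ulin : linear_for *%R (u : E -> L0 P).
  move=> c y z.
  by apply: graph_functional (uP _) (Glin _ _ _ _ _ (uP y) (uP z)).
pose l := GRing.isLinear.Build (L0 P) E (L0 P) *%R u ulin.
pose v : {scalar E} := HB.pack u l.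
by exists v => y s; exact: Gle.
Qed.

End hahn_banach.

(** * The epigraph and the barrel *)

(** The bounds force [p] and [q] to be finite, where dual addition is that of the reals. *)
Lemma dual_convex_bound (R : realType) (k a b : R) (p q : \bar R) :
  0 <= k <= 1 -> (-oo < p)%E -> (-oo < q)%E -> (p <= a%:E)%E -> (q <= b%:E)%E ->
  ((k%:E * p + (1 - k)%:E * q)%dE <= (k * a + (1 - k) * b)%:E)%E.
Proof.
move=> /andP[k0 k1]; case: p => [p| |]// _; case: q => [q| |]// _.
rewrite -!EFinM -dEFinD !lee_fin => pa qb.
by rewrite lerD// ler_wpM2l// subr_ge0.
Qed.

Lemma convex_combination_id (S : pzRingType) (V : lmodType S) (a : S) (v : V) :
  a *: v + (1 - a) *: v = v.
Proof. by rewrite -scalerDl addrC subrK scale1r. Qed.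

Section subdifferential.
Context {d : measure_display} {Omega : measurableType d} {R : realType}.
Context {P : probability Omega R}.
Variables (E : topL0Module P) (f : E -> Lbar0 P).
Implicit Types (x y z : E) (s xi eta : L0 P).
Hypothesis f_convex : L0_convex_fun f.

Lemma measurable_Lbar0 (g : Lbar0 P) : measurable_fun setT g.
Proof. exact: measurable_funPT. Qed.

Lemma Lbar0_fine (g : Lbar0 P) :
  exists r : L0 P, {ae P, forall w, r w = fine (g w)}.
Proof.
apply: L0_lift; apply: measurableT_comp; last exact: measurable_Lbar0.
exact: fine_measurable.
Qed.

(** Convexity with an indicator as weight: almost everywhere one weight is 1 and the other 0, which
    annihilates even an infinite value. *)
Lemma convex_fun_glue (A : set Omega) (mA : measurable A) y z :
  let i := L0_indic P mA in
  {ae P, forall w, A w -> (f (i *: y + (1 - i) *: z)%R w <= f y w)%E} /\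
  {ae P, forall w, ~ A w -> (f (i *: y + (1 - i) *: z)%R w <= f z w)%E}.
Proof.
move=> i; have H := f_convex y z (L0_indic_unit mA).
have iE : {ae P, forall w, i w = \1_A w} := L0_indicE mA.
split; near=> w => Aw.
- have : (f (i *: y + (1 - i) *: z)%R w <=
    ((i w)%:E * f y w + (((1 - i)%R : L0 P) w)%:E * f z w)%dE)%E by near: w.
  pw w; have -> : i w = \1_A w by near: w.
  by rewrite indicE mem_set//= subrr mul1e mul0e dadde0.
- have : (f (i *: y + (1 - i) *: z)%R w <=
    ((i w)%:E * f y w + (((1 - i)%R : L0 P) w)%:E * f z w)%dE)%E by near: w.
  pw w; have -> : i w = \1_A w by near: w.
  by rewrite indicE memNset//= subr0 mul1e mul0e dadd0e.
Unshelve. all: by end_near. Qed.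

Variables (x0 : E) (c : L0 P).
Hypothesis f_gtNy : forall x, {ae P, forall w, (-oo < f x w)%E}.
Hypothesis cE : {ae P, forall w, f x0 w = (c w)%:E}.
(** The algebraic trace of [x0] being interior to the domain, derived in [interior_absorbent]. *)
Hypothesis dom_absorbent : L0_absorbent [set y | L0_dom f (x0 + y)].

Definition epigraph y s : Prop :=
  {ae P, forall w, (f (x0 + y)%R w <= ((c + s : L0 P) w)%:E)%E}.

Lemma epigraph_convex y z s t xi : L0_unit_interval xi ->
  epigraph y s -> epigraph z t ->
  epigraph (xi *: y + (1 - xi) *: z) (xi * s + (1 - xi) * t).
Proof.
move=> xi01 ys zt; have H := f_convex (x0 + y) (x0 + z) xi01.
have xE : xi *: (x0 + y) + (1 - xi) *: (x0 + z) =
    x0 + (xi *: y + (1 - xi) *: z).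
  by rewrite !scalerDr addrACA convex_combination_id.
rewrite xE in H; have fy := f_gtNy (x0 + y); have fz := f_gtNy (x0 + z).
rewrite /epigraph; near=> w.
have h0 : (f (x0 + (xi *: y + (1 - xi) *: z))%R w <=
  ((xi w)%:E * f (x0 + y)%R w +
    (((1 - xi)%R : L0 P) w)%:E * f (x0 + z)%R w)%dE)%E by near: w.
apply: (le_trans h0).
have h1 : (f (x0 + y)%R w <= ((c + s : L0 P) w)%:E)%E by near: w.
have h2 : (f (x0 + z)%R w <= ((c + t : L0 P) w)%:E)%E by near: w.
have -> : (c + (xi * s + (1 - xi) * t) : L0 P) w =
  xi w * (c + s : L0 P) w + (1 - xi w) * (c + t : L0 P) w by pw w; ring.
have -> : (1 - xi : L0 P) w = 1 - xi w by pw w.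
by apply: dual_convex_bound => //; near: w.
Unshelve. all: by end_near. Qed.

Lemma epigraph_mono y s t : L0_le s t -> epigraph y s -> epigraph y t.
Proof.
move=> st ys; rewrite /epigraph; near=> w.
have : (f (x0 + y)%R w <= ((c + s : L0 P) w)%:E)%E by near: w.
move/le_trans; apply; rewrite lee_fin; pw w; rewrite lerD2l.
by near: w.
Unshelve. all: by end_near. Qed.

Lemma epigraph0 s : epigraph 0 s <-> L0_le 0 s.
Proof.
split => [H|s0].
  rewrite /epigraph addr0 in H; near=> w.
  have : (f x0 w <= ((c + s : L0 P) w)%:E)%E by near: w.
  have -> : f x0 w = (c w)%:E by near: w; exact: cE.
  by rewrite lee_fin; pw w; rewrite lerDl.
rewrite /epigraph addr0; near=> w.
have -> : f x0 w = (c w)%:E by near: w; exact: cE.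
rewrite lee_fin; pw w; rewrite lerDl.
have : (0 : L0 P) w <= s w by near: w.
by pw w.
Unshelve. all: by end_near. Qed.

Lemma epigraph00 : epigraph 0 0.
Proof. by apply/epigraph0; apply: aeW. Qed.

Lemma dom_epigraph y : L0_dom f (x0 + y) -> exists s, epigraph y s.
Proof.
move=> yf; have [r rE] := Lbar0_fine (f (x0 + y)).
exists (r - c); rewrite /epigraph [c + _]addrC subrK; near=> w.
have -> : r w = fine (f (x0 + y)%R w) by near: w.
have h1 : (f (x0 + y)%R w < +oo)%E by near: w; exact: yf.
have h2 : (-oo < f (x0 + y)%R w)%E by near: w; exact: f_gtNy.
by rewrite fineK// fin_real// h1 h2.
Unshelve. all: by end_near. Qed.

Lemma epigraph_absorbent y : exists t s, L0_pp t /\ epigraph (t *: y) s.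
Proof.
have [t t0 tP] := dom_absorbent y.
have /tP/dom_epigraph[s ys] := L0_norm_le_refl t0.
by exists t, s.
Qed.

(** Symmetry yields balancedness through convexity, and two-sided bounds for a linear form below the
    epigraph. *)
Definition unit_sublevel : set E := [set y | epigraph y 1 /\ epigraph (- y) 1].

(** With [xi = (1 + eta) / 2], the multiple [eta *: y] becomes a convex combination of [y] and
    [- y]. *)
Lemma L0_norm_le1_decomposition eta : L0_norm_le eta 1 ->
  exists2 xi : L0 P, L0_unit_interval xi & eta = xi - (1 - xi).
Proof.
move=> eta1; have [|h hE] := @L0_lift _ _ _ P (cst 2^-1).
  exact: measurable_cst.
exists (h * (1 + eta)).
  near=> w; pw w; have -> : h w = 2^-1 by near: w.
  have : `|eta w| <= (1 : L0 P) w by near: w.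
  by pw w; rewrite ler_norml; lra.
apply: L0_ext; near=> w; pw w; have -> : h w = 2^-1 by near: w.
by lra.
Unshelve. all: by end_near. Qed.

Lemma epigraph1_convex y z xi : L0_unit_interval xi ->
  epigraph y 1 -> epigraph z 1 -> epigraph (xi *: y + (1 - xi) *: z) 1.
Proof.
move=> xi01 y1 z1; have := epigraph_convex xi01 y1 z1.
by rewrite !mulr1 [xi + _]addrC subrK.
Qed.

Lemma unit_sublevel_balanced : L0_balanced unit_sublevel.
Proof.
move=> eta /L0_norm_le1_decomposition[xi xi01 ->] y [y1 Ny1]; split.
  by have := epigraph1_convex xi01 y1 Ny1; rewrite scalerN -scalerBl.
rewrite -scalerN scalerBl [(1 - xi) *: - y]scalerN opprK.
exact: epigraph1_convex.
Qed.

Lemma unit_sublevel_convex : L0_convex unit_sublevel.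
Proof.
move=> y z [y1 Ny1] [z1 Nz1] xi xi01; split; first exact: epigraph1_convex.
by rewrite opprD -!scalerN; exact: epigraph1_convex.
Qed.

Lemma unit_sublevel_absorbent : L0_absorbent unit_sublevel.
Proof.
move=> y; have [t t0 tP] := dom_absorbent y.
have /tP/dom_epigraph[s ys] := L0_norm_le_refl t0.
have /tP/dom_epigraph[s' Nys'] : L0_norm_le (- t) t.
  near=> w; pw w; have tw : 0 < t w by near: w.
  by rewrite normrN ger0_norm// ltW.
(* Division by this maximum brings both heights to at most 1. The 1 inside it keeps the factor [k]
   at most 1, as needed for convexity with the origin. *)
have [|a aE] := @L0_lift _ _ _ P (fun w => Num.max 1 (Num.max (s w) (s' w))).
  by do 2 (apply: measurable_maxr => //; try exact: measurable_L0).
have [|k ak k0] := @L0_inv _ _ _ P a.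
  near=> w; have -> : a w = Num.max 1 (Num.max (s w) (s' w)) by near: w.
  by rewrite lt_max ltr01.
have kP : {ae P, forall w,
    [/\ 0 <= k w <= 1, k w * s w <= 1 & k w * s' w <= 1]}.
  near=> w.
  have : (a * k : L0 P) w = (1 : L0 P) w by rewrite ak.
  have kw : 0 < k w by near: w.
  pw w; have -> : a w = Num.max 1 (Num.max (s w) (s' w)) by near: w.
  move=> <-; rewrite ![_ * k w]mulrC (ltW kw) !(ler_pM2l kw) !le_max.
  rewrite !lexx !orbT.
  by rewrite -[leLHS]mulr1 ler_pM2l// le_max lexx.
have k01 : L0_unit_interval k by apply: filterS kP => w [].
have scaled z r : epigraph (t *: z) r -> {ae P, forall w, k w * r w <= 1} ->
    epigraph ((k * t) *: z) 1.
  move=> zr kr1; have := epigraph_convex k01 zr epigraph00.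
  rewrite scaler0 mulr0 !addr0 scalerA; apply: epigraph_mono.
  by near=> w; pw w; near: w.
have kt0 : L0_pp (k * t) by near=> w; pw w; rewrite mulr_gt0//; near: w.
have [q tq q0] := L0_inv kt0.
exists (k * t) => // eta eta_le.
(* Since [eta * q] has norm at most 1, balancedness reduces the claim to the single point
   [(k * t) *: y]. *)
have -> : eta *: y = (eta * q) *: ((k * t) *: y).
  by rewrite scalerA -mulrA [q * _]mulrC tq mulr1.
apply: unit_sublevel_balanced.
  near=> w; have : `|eta w| <= (k * t : L0 P) w by near: w.
  have : (k * t * q : L0 P) w = (1 : L0 P) w by rewrite tq.
  have -> : (k * t * q : L0 P) w = (k * t : L0 P) w * q w.
    by near: w; exact: L0_ME.
  have qw : 0 < q w by near: w.
  by move=> <-; pw w; rewrite normrM (gtr0_norm qw) ler_pM2r.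
split.
  by apply: (scaled y s) => //; apply: filterS kP => w [].
rewrite -scalerN; apply: (scaled (- y) s'); first by rewrite scalerN -scaleNr.
by apply: filterS kP => w [].
Unshelve. all: by end_near. Qed.

(** Gluing [z_ n] on [A n] with [z] elsewhere gives [z] back, so [convex_fun_glue] bounds
    [f (x0 + z)] by [f (x0 + z_ n)] on [A n]. *)
Lemma epigraph_concatenation (A : nat -> set Omega)
    (mA : forall n, measurable (A n)) (z_ : nat -> E) z s :
  \bigcup_n A n = setT ->
  (forall n, L0_indic P (mA n) *: z = L0_indic P (mA n) *: z_ n) ->
  (forall n, epigraph (z_ n) s) -> epigraph z s.
Proof.
move=> Acover zE z_s.
have le_n n : {ae P, forall w, A n w ->
    (f (x0 + z)%R w <= ((c + s : L0 P) w)%:E)%E}.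
  have [le_z _] := convex_fun_glue (mA n) (x0 + z_ n) (x0 + z).
  have zE' : L0_indic P (mA n) *: (x0 + z_ n) +
      (1 - L0_indic P (mA n)) *: (x0 + z) = x0 + z.
    by rewrite !scalerDr -zE addrACA !convex_combination_id.
  rewrite zE' in le_z.
  near=> w => Aw; apply: (@le_trans _ _ (f (x0 + z_ n)%R w)).
    by move: Aw; near: w.
  by near: w; exact: z_s.
have {}le_n := ae_foralln le_n.
apply: filterS le_n => w le_w.
have [n _ /le_w//] : (\bigcup_n A n) w by rewrite Acover.
Unshelve. all: by end_near. Qed.

Lemma unit_sublevel_concatenation :
  countable_concatenation [set: E] -> countable_concatenation unit_sublevel.
Proof.
move=> Ecc A mA Apart y_ y_B.
have [y _ yE] := Ecc A mA Apart y_ (fun=> I).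
exists y => //; split.
  by apply: (epigraph_concatenation Apart.2 yE) => n; exact: (y_B n).1.
apply: (epigraph_concatenation (z_ := fun n => - y_ n) Apart.2) => n.
  by rewrite !scalerN yE.
exact: (y_B n).2.
Qed.

(** * Topological consequences of local convexity *)

Section continuity.
Hypothesis E_convex : locally_L0_convex E.

Lemma addl_continuous x : continuous (fun y : E => x + y).
Proof.
have [addc _ _] := E_convex.
move=> y; apply: (@cvg_comp _ _ _ (fun y : E => (x, y))
  (fun z : E * E => z.1 + z.2)
  (nbhs y) (nbhs (x, y))); last exact: (addc (x, y)).
exact: (@cvg_pair _ _ _ (nbhs y) (nbhs x) (nbhs y) _ _ _ _ _
  (cvg_cst x) cvg_id).
Qed.

Lemma scalel_continuous (a : L0 P) : continuous (fun y : E => a *: y).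
Proof.
have [_ scalec _] := E_convex.
move=> y; apply: (@cvg_comp _ _ _ (fun y : E => (a, y))
  (fun z : L0 P * E => z.1 *: z.2)
  (nbhs y) (nbhs (a, y))); last exact: (scalec (a, y)).
exact: (@cvg_pair _ _ _ (nbhs y) (nbhs a) (nbhs y) _ _ _ _ _
  (cvg_cst a) cvg_id).
Qed.

Lemma nbhs0_absorbent (U : set E) : nbhs (0 : E) U -> L0_absorbent U.
Proof.
have [_ _ [B BP ->]] := E_convex.
move=> [V /BP[_ Vabs _] VU] x; have [t t0 tP] := Vabs x.
by exists t => // eta /tP/VU.
Qed.

Lemma interior_absorbent : (L0_dom f)° x0 ->
  L0_absorbent [set y | L0_dom f (x0 + y)].
Proof.
move=> x0f; apply: nbhs0_absorbent.
by have := @addl_continuous x0 0 (L0_dom f); rewrite /= addr0; exact.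
Qed.

(** Both conditions are preimages of the sublevel set of [f] at [c + 1], under translation by [x0]
    and under reflection followed by it. *)
Lemma unit_sublevel_closed : L0_lower_semicontinuous f -> closed unit_sublevel.
Proof.
move=> f_lsc; apply: closedI.
  have /continuous_closedP := @addl_continuous x0.
  by move=> /(_ _ (f_lsc (c + 1))).
have : continuous (fun y : E => x0 + (-1) *: y).
  move=> y; apply: continuous_comp; first exact: scalel_continuous.
  exact: addl_continuous.
move/continuous_closedP => /(_ _ (f_lsc (c + 1))).
by congr closed; apply/seteqP; split=> y /=; rewrite scaleN1r.
Qed.

(** On [unit_sublevel] the form [u] has absolute value at most 1; scaling that set by [e] and
    translating it to [y] gives a neighborhood on which [u] varies by at most [e]. *)
Lemma bounded_linear_continuous (u : {scalar E}) :
  nbhs (0 : E) unit_sublevel ->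
  (forall y s, epigraph y s -> L0_le (u y) s) -> continuous (u : E -> L0 P).
Proof.
move=> nB u_le y A [e e0 eA].
have [v ev v0] := L0_inv e0.
have gc : continuous (fun z : E => v *: (- y + z)).
  move=> z; apply: continuous_comp; first exact: addl_continuous.
  exact: scalel_continuous.
have : nbhs y [set z | unit_sublevel (v *: (- y + z))].
  by apply: gc; rewrite /= addNr scaler0.
apply: filterS => z [/u_le le1 /u_le le2]; apply: eA => /=.
have uE : u z - u y = e * u (v *: (- y + z)).
  by rewrite linearZ linearD linearN /= mulrA ev mul1r addrC.
rewrite linearN in le2.
rewrite uE; near=> w; pw w.
have : (u (v *: (- y + z)) : L0 P) w <= (1 : L0 P) w by near: w.
have : (- u (v *: (- y + z)) : L0 P) w <= (1 : L0 P) w by near: w.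
have ew : 0 < e w by near: w.
pw w => h1 h2; rewrite normrM (gtr0_norm ew) ger_pMr// ler_norml h2 andbT.
by rewrite lerNl.
Unshelve. all: by end_near. Qed.

End continuity.

(** As [f y] may be infinite on part of [Omega], [y] is replaced by [x0] there. The bound at the
    glued point gives the inequality where [f y] is finite; elsewhere the right-hand side is
    [+oo]. *)
Lemma subgradient_of_epigraph (u : {scalar E}) :
  (forall y s, epigraph y s -> L0_le (u y) s) -> forall y, {ae P, forall w,
    (((u (y - x0)%R : L0 P) w)%:E <= (f y w - f x0 w)%dE)%E}.
Proof.
move=> u_le y.
pose A := [set w | f y w != +oo%E].
have mA : measurable A.
  have -> : A = setT `&` f y @^-1` (~` [set +oo%E]).
    by rewrite setTI; apply/seteqP; split=> w /= /eqP.
  by apply: measurable_Lbar0 => //; apply: measurableC; exact: emeasurable_set1.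
(* [fine] sends [+oo] to 0, a default that the factor [i] cancels. *)
have [r rE] := Lbar0_fine (f y).
pose i := L0_indic P mA.
have iE : {ae P, forall w, i w = \1_A w} := L0_indicE mA.
have [leA leNA] := convex_fun_glue mA y x0.
have fy := f_gtNy y.
have : epigraph (i *: (y - x0)) (i * (r - c)).
  rewrite /epigraph.
  have -> : x0 + i *: (y - x0) = i *: y + (1 - i) *: x0.
    by rewrite scalerBr scalerBl scale1r addrCA.
  near=> w; have [Aw|Aw] := pselect (A w).
    have : (f (i *: y + (1 - i) *: x0)%R w <= f y w)%E by move: Aw; near: w.
    move=> /le_trans; apply; pw w.
    have -> : i w = \1_A w by near: w.
    have -> : r w = fine (f y w) by near: w.
    rewrite indicE mem_set// mul1r addrCA subrr addr0 fineK//.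
    by rewrite fin_numE Aw andbT -ltNye; near: w.
  have : (f (i *: y + (1 - i) *: x0)%R w <= f x0 w)%E by move: Aw; near: w.
  move=> /le_trans; apply; pw w.
  have -> : i w = \1_A w by near: w.
  have -> : f x0 w = (c w)%:E by near: w; exact: cE.
  by rewrite indicE memNset// mul0r addr0.
move=> /u_le; rewrite linearZ /= => u_w.
near=> w.
have -> : f x0 w = (c w)%:E by near: w; exact: cE.
have [Aw|] := pselect (A w); last first.
  by move=> /negP; rewrite negbK => /eqP ->; rewrite /= leey.
have : (i * u (y - x0) : L0 P) w <= (i * (r - c) : L0 P) w by near: w.
pw w.
have -> : i w = \1_A w by near: w.
have -> : r w = fine (f y w) by near: w.
rewrite indicE mem_set// !mul1r -lee_fin => /le_trans; apply.
rewrite -[in leRHS](@fineK _ (f y w)); first by [].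
by rewrite fin_numE Aw andbT -ltNye; near: w.
Unshelve. all: by end_near. Qed.

End subdifferential.

Theorem theorem4p3 (d : measure_display) (Omega : measurableType d)
  (R : realType) (P : probability Omega R) (E : topL0Module P)
  (E_separated : concatenation_separated E)
  (E_pre_barreled : L0_pre_barreled E)
  (E_concatenation : countable_concatenation [set: E])
  (f : E -> Lbar0 P) (f_proper : L0_proper f)
  (f_lsc : L0_lower_semicontinuous f) (f_convex : L0_convex_fun f) :
  forall x : E, (L0_dom f)° x -> L0_subdifferential f x !=set0.
Proof.
move=> x0 x0f; have [E_convex E_barrel] := E_pre_barreled.
have [_ f_gtNy] := f_proper.
have [c cE] := Lbar0_fine (f x0).
(* An interior point lies in the domain and properness excludes [-oo], so [f x0] is finite almost
   surely. *)
have {}cE : {ae P, forall w, f x0 w = (c w)%:E}.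
  have x0_dom : L0_dom f x0 := interior_subset x0f.
  near=> w; have -> : c w = fine (f x0 w) by near: w.
  have h1 : (f x0 w < +oo)%E by near: w; exact: x0_dom.
  have h2 : (-oo < f x0 w)%E by near: w; exact: f_gtNy.
  by rewrite fineK// fin_real// h1 h2.
have dom_abs := interior_absorbent E_convex x0f.
(* The separation is algebraic; continuity of [u] comes afterwards from the barrel. *)
have [u u_le] : exists u : {scalar E},
    forall y s, epigraph f x0 c y s -> L0_le (u y) s.
  apply: L0_hahn_banach.
  - by move=> y y' s s' xi; exact: epigraph_convex.
  - exact: epigraph00.
  - by move=> r /(epigraph0 cE).
  - exact: epigraph_absorbent.
exists u; split; last exact: (subgradient_of_epigraph f_convex f_gtNy cE u_le).
apply: (bounded_linear_continuous E_convex _ u_le).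
apply: E_barrel; last exact: unit_sublevel_concatenation.
split.
- exact: unit_sublevel_balanced.
- exact: (unit_sublevel_absorbent f_convex f_gtNy cE).
- exact: unit_sublevel_convex.
- exact: unit_sublevel_closed.
Unshelve. all: by end_near. Qed.
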